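(* Let $(\gamma,\nu):I\to\mathbb{R}^2\times S^1$ be a Legendre curve with curvature $(\ell,\beta)$ such that there exists a smooth map $(k_1,k_2):I\to\mathbb{R}^2\setminus\{0\}$ with $k_1(t)\ell(t)+k_2(t)\beta(t)=0$ for all $t\in I$. Let $A=\begin{pmatrix} a_{11} & a_{12} \\ a_{21} & a_{22} \end{pmatrix}\in GL(2,\mathbb{R})$ and let $(\gamma[A],\nu[A]):I\to\mathbb{R}^2\times S^1$ be a Legendre curve with curvature $(\ell[A],\beta[A])=(a_{11}\ell+a_{12}\beta,\;a_{21}\ell+a_{22}\beta)$. Then $t_0\in I$ is a vertex of $\gamma$ if and only if $t_0$ is a vertex of $\gamma[A]$.
   Context: All maps are $C^\infty$; $I$ is a closed interval. $\mathbb{R}^2$ has the standard inner product, $S^1\subset\mathbb{R}^2$ is the unit circle, and $J(x,y)=(-y,x)$. A smooth map $(\gamma,\nu):I\to\mathbb{R}^2\times S^1$ is a Legendre curve if $\dot\gamma(t)\cdot\nu(t)=0$ for all $t\in I$; then $\gamma$ is called a frontal. Put $\mu=J(\nu)$. The curvature $(\ell,\beta)$ is $\ell=\dot\nu\cdot\mu$, $\beta=\dot\gamma\cdot\mu$, so that $\dot\nu=\ell\mu$, $\dot\mu=-\ell\nu$, $\dot\gamma=\beta\mu$. Vertex (general case): for a Legendre curve with curvature $(\ell,\beta)$ defined on $I$, a point $t_0\in I$ is a vertex if there is a smooth map $(k_1,k_2):I\to\mathbb{R}^2\setminus\{0\}$ with $k_1\ell+k_2\beta=0$ on $I$ and $\dot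 k_1(t_0)k_2(t_0)-k_1(t_0)\dot k_2(t_0)=0$. *)

(* Defs.v *)
From HB Require Import structures.
From mathcomp Require Import all_boot all_order all_algebra.
From mathcomp Require Import all_classical all_reals all_analysis.
Import Order.TTheory GRing.Theory Num.Theory.
Import numFieldNormedType.Exports.

Set Implicit Arguments.
Unset Strict Implicit.
Unset Printing Implicit Defensive.

Local Open Scope classical_set_scope.
Local Open Scope ring_scope.

(** A map defined on [I] is represented by a total function on [R] of which
    only the values on [I] matter: limits are taken within [I], so that the
    derivative is one-sided at an endpoint of [I]. *)
Definition diff_quot (R : realType) (V : normedModType R)
    (f : R -> V) (t : R) : R -> V :=
  fun s => (s - t)^-1 *: (f s - f t).

Definition derivable_on (R : realType) (V : normedModType R)
    (I : set R) (f : R -> V) : Prop :=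
  forall t, I t -> cvg (diff_quot f t @ within I t^').

Definition deriv_on (R : realType) (V : normedModType R)
    (I : set R) (f : R -> V) (t : R) : V :=
  lim (diff_quot f t @ within I t^').

(** [f] is of class C^oo on [I]: derivatives of all orders exist on [I]. *)
Definition smooth_on (R : realType) (V : normedModType R)
    (I : set R) (f : R -> V) : Prop :=
  forall n : nat, derivable_on I (iter n (deriv_on I) f).

Definition dot (R : realType) (u v : 'rV[R]_2) : R :=
  \sum_(i < 2) u 0 i * v 0 i.

Definition rotJ (R : realType) (v : 'rV[R]_2) : 'rV[R]_2 :=
  \row_(i < 2) (if i == 0 then - v 0 1 else v 0 0).

Definition legendre_curve (R : realType) (I : set R)
    (gamma nu : R -> 'rV[R]_2) : Prop :=
  [/\ smooth_on I gamma, smooth_on I nu,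
      forall t, I t -> dot (nu t) (nu t) = 1 &
      forall t, I t -> dot (deriv_on I gamma t) (nu t) = 0].

Definition curv_ell (R : realType) (I : set R)
    (nu : R -> 'rV[R]_2) (t : R) : R :=
  dot (deriv_on I nu t) (rotJ (nu t)).

Definition curv_beta (R : realType) (I : set R)
    (gamma nu : R -> 'rV[R]_2) (t : R) : R :=
  dot (deriv_on I gamma t) (rotJ (nu t)).

(** [k = (k_1, k_2)] is a smooth map [I -> R^2 \ {0}] with
    [k_1 ell + k_2 beta = 0] on [I]. *)
Definition annihilates_curvature (R : realType) (I : set R)
    (gamma nu k : R -> 'rV[R]_2) : Prop :=
  [/\ smooth_on I k,
      forall t, I t -> k t != 0 &
      forall t, I t ->
        k t 0 0 * curv_ell I nu t + k t 0 1 * curv_beta I gamma nu t = 0].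

Definition is_vertex (R : realType) (I : set R)
    (gamma nu : R -> 'rV[R]_2) (t0 : R) : Prop :=
  I t0 /\
  exists2 k : R -> 'rV[R]_2, annihilates_curvature I gamma nu k &
    deriv_on I k t0 0 0 * k t0 0 1 - k t0 0 0 * deriv_on I k t0 0 1 = 0.

(* Main.v *)
Require Import Defs.
From mathcomp Require Import all_boot all_order all_algebra.
From mathcomp Require Import all_classical all_reals all_analysis.
From mathcomp Require Import ring.
Import Order.TTheory GRing.Theory Num.Theory.
Import numFieldNormedType.Exports.

Local Open Scope classical_set_scope.
Local Open Scope ring_scope.

(** If [(l, b) = M (l', b')] pointwise and the row vector [k] annihilates
    [(l, b)], then [k M] annihilates [(l', b')]; moreover [k M] is smooth and
    nowhere zero when [k] is, and its Wronskian is [det M] times that of [k].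
    Taking [M = A^-1] and [M = A] gives the two implications. *)

Lemma within_fmap_eq {T U : Type} (F : set_system T) (I : set T) (f g : T -> U) :
  {in I, f =1 g} -> f @ within I F = g @ within I F.
Proof.
move=> fg; apply/funext => V; rewrite /fmap /within /=; congr (F _).
apply/seteqP; split=> x /= h Ix; [rewrite -fg|rewrite fg]; by [exact: h|rewrite inE].
Qed.

Lemma continuous_mulmxr {R : realType} {n p : nat} (M : 'M[R]_(n, p)) :
  continuous (fun x : 'rV[R]_n => x *m M).
Proof.
(* Expanding along the rows of [M] reduces the claim to continuity of the coordinates. *)
have -> : (fun x : 'rV[R]_n => x *m M) = fun x => \sum_i x 0 i *: row i M.
  by apply/funext => x; exact: mulmx_sum_row.
apply: continuous_big => [|i _ x]; first exact: add_continuous.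
apply: cvgZr_tmp; first exact: (nbhs_filter x).
exact: coord_continuous.
Qed.

(** Since [a < b], no point of the interval is isolated. Properness makes limits along this filter
    unique, so that a proof of convergence determines the value of [deriv_on]. *)
Lemma within_dnbhs_itv_proper {R : realType} (a b t : R) :
  a < b -> t \in `[a, b] -> ProperFilter (within `[a, b] t^').
Proof.
move=> ab; rewrite in_itv /= => /andP[at_ tb].
apply: Build_ProperFilter_ex => V.
rewrite /within /= => /nbhs_ballP[e /= e0 h].
have [tb'|bt] := ltP t b.
  (* There is room to the right of [t]: move by at most half the radius, capped at [b] to stay in
     the interval. *)
  set s := Num.min b (t + e / 2).
  have ts : t < s by rewrite lt_min tb' ltrDl divr_gt0.
  exists s; apply: h; rewrite /= ?in_itv/=.
  - rewrite /ball /= distrC ger0_norm ?subr_ge0 ?(ltW ts)//.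
    rewrite ltrBlDl (@le_lt_trans _ _ (t + e / 2)) ?ge_min ?lexx ?orbT//.
    by rewrite ltrD2l ltr_pdivrMr// ltr_pMr// ltr1n.
  - by rewrite gt_eqF.
  - by rewrite (le_trans at_ (ltW ts)) ge_min lexx.
have at' : a < t by exact: lt_le_trans bt.
(* Here [t] is the right endpoint, so the witness is taken on its left, capped at [a]. *)
set s := Num.max a (t - e / 2).
have st : s < t by rewrite gt_max at' ltrBlDr ltrDl divr_gt0.
exists s; apply: h; rewrite /= ?in_itv/=.
- rewrite /ball /= ger0_norm ?subr_ge0 ?(ltW st)//.
  rewrite ltrBlDl -ltrBlDr (@lt_le_trans _ _ (t - e / 2)) ?le_max ?lexx ?orbT//.
  by rewrite ltrD2l ltrN2 ltr_pdivrMr// ltr_pMr// ltr1n.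
- by rewrite lt_eqF.
- by rewrite le_max lexx (le_trans (ltW st) tb).
Qed.

Section DerivativeOnInterval.
Context {R : realType}.

Lemma diff_quot_eq_on {V : normedModType R} (I : set R) (f g : R -> V) (t : R) :
  {in I, f =1 g} -> I t ->
  diff_quot f t @ within I t^' = diff_quot g t @ within I t^'.
Proof.
move=> fg It; apply: within_fmap_eq => s Is.
by rewrite /diff_quot fg// fg// inE.
Qed.

Variables (a b : R).
Hypothesis ab : a < b.
Let I : set R := `[a, b].

(** By linearity, forming the difference quotient commutes with multiplication by [M]; continuity of
    this multiplication then carries the limit over. *)
Lemma diff_quot_mulmxr_cvg {n p : nat} (M : 'M[R]_(n.+1, p.+1))
    (f : R -> 'rV[R]_n.+1) (t : R) :
  cvg (diff_quot f t @ within I t^') ->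
  diff_quot (fun s => f s *m M) t @ within I t^' --> deriv_on I f t *m M.
Proof.
move=> cf.
have -> : diff_quot (fun s => f s *m M) t = (fun x => x *m M) \o diff_quot f t.
  by apply/funext => s; rewrite /diff_quot /= -scalemxAl mulmxBl.
exact: (cvg_comp _ _ cf (continuous_mulmxr M _)).
Qed.

Lemma deriv_on_mulmxr {n p : nat} (M : 'M[R]_(n.+1, p.+1))
    (f : R -> 'rV[R]_n.+1) (t : R) : I t ->
  cvg (diff_quot f t @ within I t^') ->
  deriv_on I (fun s => f s *m M) t = deriv_on I f t *m M.
Proof.
move=> It cf; have pf := within_dnbhs_itv_proper _ _ _ ab It.
by apply: cvg_lim => //; exact: diff_quot_mulmxr_cvg.
Qed.

Lemma smooth_on_mulmxr {n p : nat} (M : 'M[R]_(n.+1, p.+1))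
    (f : R -> 'rV[R]_n.+1) :
  smooth_on I f -> smooth_on I (fun s => f s *m M).
Proof.
move=> sf.
(* The identity is claimed on [I] only, where [deriv_on] is controlled. This is enough for the
   induction, because difference quotients at a point of [I] are taken along points of [I]. *)
have iterM m : {in I, iter m (deriv_on I) (fun s => f s *m M) =1
                      (fun s => iter m (deriv_on I) f s *m M)}.
  elim: m => [//|m IHm] t; rewrite inE => It /=.
  rewrite {1}/deriv_on (diff_quot_eq_on _ _ _ _ IHm It).
  exact: deriv_on_mulmxr It (sf m t It).
move=> m t It; rewrite (diff_quot_eq_on _ _ _ _ (iterM m) It).
by apply/cvg_ex; eexists; apply: diff_quot_mulmxr_cvg; exact: sf.
Qed.

Lemma is_vertex_linear_change (M : 'M[R]_2) (gamma nu gamma' nu' : R -> 'rV[R]_2)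
    (t0 : R) : M \in unitmx ->
  (forall t, I t -> curv_ell I nu t =
     M 0 0 * curv_ell I nu' t + M 0 1 * curv_beta I gamma' nu' t) ->
  (forall t, I t -> curv_beta I gamma nu t =
     M 1 0 * curv_ell I nu' t + M 1 1 * curv_beta I gamma' nu' t) ->
  is_vertex I gamma nu t0 -> is_vertex I gamma' nu' t0.
Proof.
move=> uM ell beta [It0 [k [sk k0 kl] wk]].
have mulE (v : 'rV[R]_2) j : (v *m M) 0 j = v 0 0 * M 0 j + v 0 1 * M 1 j.
  (* The second index produced by [big_ord_recl] has the value of [1] but is a different term, hence
     [val_inj]. *)
  by rewrite mxE big_ord_recl big_ord1; congr (_ + v 0 _ * M _ _); exact/val_inj.
split=> //; exists (fun t => k t *m M).
  split; first exact: smooth_on_mulmxr.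
  - move=> t It; apply: contra_neq (k0 t It) => kM0.
    by rewrite -(mulmxK uM (k t)) kM0 mul0mx.
  (* Associativity: pairing [k M] with the new curvature is pairing [k] with [M] times it, which is
     the old curvature. *)
  - move=> t It; rewrite !mulE -(kl t It) ell// beta//; ring.
rewrite deriv_on_mulmxr//; last exact: (sk 0).
rewrite !mulE.
(* The first factor is the determinant of [M], written out. *)
transitivity ((M 0 0 * M 1 1 - M 0 1 * M 1 0) *
  (deriv_on I k t0 0 0 * k t0 0 1 - k t0 0 0 * deriv_on I k t0 0 1)).
  ring.
by rewrite wk mulr0.
Qed.

End DerivativeOnInterval.

Lemma invmx_pair {R : realType} (A : 'M[R]_2) (l b l' b' : R) : A \in unitmx ->
  l' = A 0 0 * l + A 0 1 * b -> b' = A 1 0 * l + A 1 1 * b ->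
  l = invmx A 0 0 * l' + invmx A 0 1 * b' /\
  b = invmx A 1 0 * l' + invmx A 1 1 * b'.
Proof.
move=> uA -> ->.
(* These are the entries of the identity matrix, as products of a row of the inverse with a column
   of [A]. *)
have VA i j : invmx A i 0 * A 0 j + invmx A i 1 * A 1 j = (i == j)%:R.
  have /matrixP/(_ i j) := mulVmx uA; rewrite !mxE big_ord_recl big_ord1 => <-.
  by congr (_ + invmx A i _ * A _ j); exact/val_inj.
have VAE i : invmx A i 0 * (A 0 0 * l + A 0 1 * b) +
    invmx A i 1 * (A 1 0 * l + A 1 1 * b) = (i == 0)%:R * l + (i == 1)%:R * b.
  rewrite -!VA; ring.
by rewrite !VAE /= !mul1r !mul0r addr0 add0r.
Qed.

Theorem proposition4p4 (R : realType) (a b : R) (hab : a < b)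
    (gamma nu : R -> 'rV[R]_2)
    (hL : legendre_curve `[a, b] gamma nu)
    (hk : exists k : R -> 'rV[R]_2, annihilates_curvature `[a, b] gamma nu k)
    (A : 'M[R]_2) (hA : A \in unitmx)
    (gammaA nuA : R -> 'rV[R]_2)
    (hLA : legendre_curve `[a, b] gammaA nuA)
    (hell : forall t, t \in `[a, b] ->
       curv_ell `[a, b] nuA t =
         A 0 0 * curv_ell `[a, b] nu t
         + A 0 1 * curv_beta `[a, b] gamma nu t)
    (hbeta : forall t, t \in `[a, b] ->
       curv_beta `[a, b] gammaA nuA t =
         A 1 0 * curv_ell `[a, b] nu t
         + A 1 1 * curv_beta `[a, b] gamma nu t)
    (t0 : R) (ht0 : t0 \in `[a, b]) :
  is_vertex `[a, b] gamma nu t0 <-> is_vertex `[a, b] gammaA nuA t0.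
Proof.
(* From [gammaA] back to [gamma], the hypotheses already have the required form with [M = A]; the
   forward direction first solves them for the curvature of [gamma]. *)
split; last exact: (is_vertex_linear_change _ _ hab A).
have inv t (It : t \in `[a, b]) := invmx_pair _ _ _ _ _ hA (hell t It) (hbeta t It).
apply: (is_vertex_linear_change _ _ hab (invmx A)); first by rewrite unitmx_inv.
- by move=> t /inv[].
- by move=> t /inv[].
Qed.
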